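(* Let $H_1,H_2$ be real Hilbert spaces, let $C\subset H_1$ and $Q\subset H_2$ be nonempty closed convex subsets, and let $A:H_1\to H_2$ be a bounded linear operator. Let $f:C\times C\to\mathbb{R}$ and $g:Q\times Q\to\mathbb{R}$ be bifunctions that are upper semi-continuous in the first variable. Then the split equilibrium problem (SEP) determined by $(C,Q,A,f,g)$ is well-posed if and only if $$S(\epsilon)\neq\emptyset\ \text{ for all }\epsilon>0\quad\text{and}\quad \lim_{\epsilon\to 0}\operatorname{diam}(S(\epsilon))=0$$ (where $\epsilon>0$ in the limit).
   Context: The product $H_1\times H_2$ carries its usual Hilbert space norm. Split equilibrium problem (SEP): find $x^*\in C$ such that $f(x^*,p)\ge 0$ for all $p\in C$, and such that $y^*=Ax^*$ belongs to $Q$ and satisfies $g(y^*,q)\ge 0$ for all $q\in Q$. A solution is identified with the pair $(x^*,y^* )=(x^*,Ax^* )$, so the solution set is $$S=\{(x,y)\in C\times Q:\ y=Ax,\ f(x,p)\ge 0\ \forall p\in C,\ g(y,q)\ge 0\ \forall q\in Q\}.$$ For $\epsilon\ge 0$, the approximate solution set is $$S(\epsilon)=\{(x,y)\in C\times Q:\ \|y-Ax\|\le\epsilon,\ f(x,p)\ge-\epsilon\ \forall p\in C,\ g(y,q)\ge-\epsilon\ \forall q\in Q\}.$$ A sequence $\{(x_n,y_n)\}$ in $H_1\times H_2$ is an approximating sequence for the SEP if there exist real numbers $\epsilon_n>0$ with $\epsilon_n\to 0$ such that, for all $n$: $x_n\in C$, $y_n\in Q$, $\|y_n-Ax_n\|\le\epsilon_n$,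 $f(x_n,p)\ge-\epsilon_n$ for all $p\in C$, and $g(y_n,q)\ge-\epsilon_n$ for all $q\in Q$. The SEP is well-posed if $S$ is a singleton and every approximating sequence for the SEP converges (in norm) to the unique element of $S$. The diameter of a set $B$ is $\operatorname{diam}(B)=\sup\{\|u-v\|:u,v\in B\}$ (possibly $+\infty$). A function $h:K\to\mathbb{R}$ on a subset $K$ of a Hilbert space is upper semi-continuous if for every $x\in K$ and every sequence $\{x_n\}$ in $K$ with $x_n\to x$ in norm, $\limsup_{n\to\infty}h(x_n)\le h(x)$. The bifunctions being upper semi-continuous in the first variable means that $f(\cdot,p)$ is upper semi-continuous on $C$ for each $p\in C$ and $g(\cdot,q)$ is upper semi-continuous on $Q$ for each $q\in Q$. *)

(* Defs.v *)
From HB Require Import structures.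
From mathcomp Require Import all_boot all_order all_algebra.
From mathcomp Require Import all_classical all_reals all_analysis.

Set Implicit Arguments.
Unset Strict Implicit.
Unset Printing Implicit Defensive.

Import Order.TTheory GRing.Theory Num.Theory.
Import numFieldNormedType.Exports.

Local Open Scope classical_set_scope.
Local Open Scope ring_scope.

HB.mixin Record NormedModule_isInner (R : realType) H of NormedModule R H := {
  inner : {dot H for idfun};
  inner_norm : forall x : H, inner x x = `|x| ^+ 2
}.

#[short(type="hilbertType")]
HB.structure Definition Hilbert (R : realType) :=
  {H of CompleteNormedModule R H & NormedModule_isInner R H}.

Definition bounded_operator (R : realType) (V W : normedModType R)
    (A : V -> W) : Prop :=
  exists M : R, forall x, `|A x| <= M * `|x|.

Definition usc_on (R : realType) (V : normedModType R) (K : set V)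
    (h : V -> R) : Prop :=
  forall (x : V) (u : V^nat), K x -> (forall n, K (u n)) ->
    u @ \oo --> x -> (limn_esup (fun n => (h (u n))%:E) <= (h x)%:E)%E.

Section SplitEquilibrium.
Context {R : realType} {H1 H2 : hilbertType R}.
Implicit Types (z : H1 * H2) (B : set (H1 * H2)).

(* The library's canonical norm on [H1 * H2] is the max norm, hence this one. *)
Definition hnorm z : R := Num.sqrt (`|z.1| ^+ 2 + `|z.2| ^+ 2).

(* Over the extended reals, so [+oo] if unbounded; [hdiam set0 = -oo]. *)
Definition hdiam B : \bar R :=
  ereal_sup [set (hnorm (u - v))%:E | u in B & v in B].

(* A bifunction on [C] is a total function whose values off [C] are never
   used below; likewise for [Q]. *)
Variables (C : set H1) (Q : set H2) (A : H1 -> H2).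
Variables (f : H1 -> H1 -> R) (g : H2 -> H2 -> R).

Definition sep_sol : set (H1 * H2) :=
  [set z | [/\ C z.1 /\ Q z.2,
               z.2 = A z.1,
               forall p, C p -> 0 <= f z.1 p
             & forall q, Q q -> 0 <= g z.2 q]].

Definition sep_approx_sol (e : R) : set (H1 * H2) :=
  [set z | [/\ C z.1 /\ Q z.2,
               `|z.2 - A z.1| <= e,
               forall p, C p -> - e <= f z.1 p
             & forall q, Q q -> - e <= g z.2 q]].

Definition approximating_seq (z : (H1 * H2)^nat) : Prop :=
  exists e : R^nat, [/\ forall n, 0 < e n,
                        e @ \oo --> (0 : R)
                      & forall n, sep_approx_sol (e n) (z n)].

Definition sep_well_posed : Prop :=
  exists2 z0, sep_sol = [set z0] &
    forall z : (H1 * H2)^nat, approximating_seq z ->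
      hnorm (z n - z0) @[n --> \oo] --> (0 : R).

End SplitEquilibrium.

(* Main.v *)
Require Import Defs.
From HB Require Import structures.
From mathcomp Require Import all_boot all_order all_algebra.
From mathcomp Require Import all_classical all_reals all_analysis.
Import Order.TTheory GRing.Theory Num.Theory.
Import numFieldNormedType.Exports.
Local Open Scope classical_set_scope.
Local Open Scope ring_scope.

(** Let [S e] denote the set of [e]-approximate solutions. These sets shrink
    with [e], contain the solution set when [0 <= e], and every approximating sequence runs through sets [S (e n)] with [e n --> 0].
    Because [S e] is monotone in [e] and nonempty, [diam (S e) --> 0] means
    that for each [r > 0] some [S d] with [d > 0] has all its mutual distances
    at most [r] ([hdiam_cvg0P]); the proof works with this form only.

    If the problem is well-posed with solution [z0], then [z0] lies in each
    [S e], and some [S e] is contained in any given ball around [z0]: otherwise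
    one could pick in each [S (1 / n.+1)] a point far away from [z0], and these
    points would form an approximating sequence that does not converge to [z0].

    Conversely, let the [S e] be nonempty with diameter tending to [0]. Points
    [z n] of [S (1 / n.+1)] form a Cauchy sequence, since all but finitely many
    of them lie in a common [S d] of small diameter. Its limit solves the
    problem ([approximating_seq_limit]): [C] and [Q] are closed, the residual
    [y - A x] is continuous since [A] is bounded, and the inequalities for [f]
    and [g] survive the limit by upper semi-continuity ([usc_limit_ge0]). The
    solution is unique, and the terms of any approximating sequence approach it,
    because the solution and the n-th term both belong to [S (e n)]. *)

Set Implicit Arguments.
Unset Strict Implicit.

(** * The Hilbert norm on the product *)

Lemma ler_hnorm1 (R : realType) (H1 H2 : hilbertType R) (z : H1 * H2) :
  `|z.1| <= hnorm z.
Proof.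
rewrite /hnorm -[leLHS]ger0_norm// -sqrtr_sqr ler_wsqrtr// lerDl.
exact: sqr_ge0.
Qed.

Lemma ler_hnorm2 (R : realType) (H1 H2 : hilbertType R) (z : H1 * H2) :
  `|z.2| <= hnorm z.
Proof.
rewrite /hnorm -[leLHS]ger0_norm// -sqrtr_sqr ler_wsqrtr// lerDr.
exact: sqr_ge0.
Qed.

Lemma hnorm_le_add (R : realType) (H1 H2 : hilbertType R) (z : H1 * H2) :
  hnorm z <= `|z.1| + `|z.2|.
Proof.
have z_ge0 : 0 <= `|z.1| + `|z.2| by rewrite addr_ge0.
rewrite /hnorm -[leRHS]ger0_norm// -sqrtr_sqr ler_wsqrtr//.
by rewrite sqrrD lerD2r lerDl mulrn_wge0 ?mulr_ge0.
Qed.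

(** The factor 4 comes from comparing [hnorm] with the sum of the component
    norms, which gives a triangle inequality without Minkowski's inequality;
    for limits any constant does. *)
Lemma hnorm_dist_le (R : realType) (H1 H2 : hilbertType R) (u v w : H1 * H2)
    (r : R) :
  hnorm (u - w) <= r -> hnorm (v - w) <= r -> hnorm (u - v) <= r *+ 4.
Proof.
move=> uw vw; apply: le_trans (hnorm_le_add _) _ => /=.
have uw1 := le_trans (ler_hnorm1 _) uw; have uw2 := le_trans (ler_hnorm2 _) uw.
have vw1 := le_trans (ler_hnorm1 _) vw; have vw2 := le_trans (ler_hnorm2 _) vw.
rewrite -[4%N]/(2 + 2)%N mulrnDr; apply: lerD; rewrite mulr2n.
- by apply: le_trans (ler_distD w.1 _ _) _; rewrite lerD// distrC.
- by apply: le_trans (ler_distD w.2 _ _) _; rewrite lerD// distrC.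
Qed.

Lemma hnorm_le0_eq0 (R : realType) (H1 H2 : hilbertType R) (z : H1 * H2) :
  hnorm z <= 0 -> z = 0.
Proof.
case: z => x y z_le0; congr pair; apply/eqP; rewrite -normr_le0.
- exact: le_trans (ler_hnorm1 (x, y)) z_le0.
- exact: le_trans (ler_hnorm2 (x, y)) z_le0.
Qed.

(** * Limits of sequences *)

(** Completeness is available in each factor for its own norm, so this is
    applied to the two components of a sequence in the product separately. *)
Lemma dist_small_cvgn (R : realType) (V : completeNormedModType R) (u : V^nat) :
  (forall r, 0 < r -> exists N, forall n, (N <= n)%N -> `|u N - u n| <= r) ->
  cvgn u.
Proof.
move=> u_small; apply/cauchy_cvgP/cauchyP => r r_gt0.
have [|N uN] := u_small (r / 2); first by rewrite divr_gt0.
exists (u N); exists N => // n /= Nn; rewrite -ball_normE /=.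
apply: le_lt_trans (uN n Nn) _.
by rewrite ltr_pdivrMr// ltr_pMr// ltr1n.
Qed.

Lemma le_limn_esup (R : realType) (u v : R^nat) (l : R) :
  v @ \oo --> l -> (forall n, v n <= u n) ->
  (l%:E <= limn_esup (fun n => (u n)%:E))%E.
Proof.
move=> v_l vu; have vE_l : (fun n => (v n)%:E) @ \oo --> l%:E.
  by apply: cvg_EFin => //; exact: nearW.
rewrite limn_esup_lim -(cvg_lim _ vE_l)//; apply: lee_lim.
- by apply/cvg_ex; exists l%:E.
- exact: is_cvg_esups.
apply: nearW => n; apply: (@le_trans _ _ (u n)%:E); first by rewrite lee_fin.
by apply: ereal_sup_ubound; exists n => /=.
Qed.

(** Approximate inequalities pass to the limit: upper semi-continuity bounds
    [h x] from below by the limsup of the values along the sequence, and this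
    limsup dominates [lim (- e n) = 0]. *)
Lemma usc_limit_ge0 (R : realType) (V : normedModType R) (K : set V) (h : V -> R)
    (u : V^nat) (x : V) (e : R^nat) :
  usc_on K h -> K x -> (forall n, K (u n)) -> u @ \oo --> x ->
  e @ \oo --> (0 : R) -> (forall n, - e n <= h (u n)) -> 0 <= h x.
Proof.
move=> h_usc Kx Ku u_x e0 hu; rewrite -lee_fin.
apply: le_trans (h_usc _ _ Kx Ku u_x); apply: le_limn_esup hu.
by rewrite -oppr0; exact: cvgN.
Qed.

Lemma bounded_operator_cvg (R : realType) (V W : normedModType R)
    (A : {linear V -> W}) (x : V) (u : V^nat) :
  bounded_operator A -> u @ \oo --> x -> A (u n) @[n --> \oo] --> A x.
Proof.
move=> [M AM] u_x; apply/subr_cvg0/norm_cvg0P.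
apply: (@squeeze_cvgr _ _ _ _ (cst 0) (fun n => M * `|u n - x|)).
- by apply: nearW => n; rewrite /= normr_ge0 -linearB AM.
- exact: cvg_cst.
- rewrite -(mulr0 M); apply: cvgMl_tmp => //.
  by apply/norm_cvg0P/subr_cvg0.
Qed.

(** * Sets of vanishing diameter *)

Lemma hdiam_le (R : realType) (H1 H2 : hilbertType R) (B : set (H1 * H2))
    (r : R) :
  (hdiam B <= r%:E)%E <-> forall u v, B u -> B v -> hnorm (u - v) <= r.
Proof.
split=> [Br u v Bu Bv|Br].
  rewrite -lee_fin; apply: le_trans Br; apply: ereal_sup_ubound.
  by exists u => //; exists v.
by apply: ge_ereal_sup => _ [u Bu [v Bv <-]]; rewrite lee_fin Br.
Qed.

Lemma hdiam_ge0 (R : realType) (H1 H2 : hilbertType R) (B : set (H1 * H2)) :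
  B !=set0 -> (0 <= hdiam B)%E.
Proof.
move=> [u Bu]; apply: (@le_trans _ _ (hnorm (u - u))%:E).
  by rewrite lee_fin sqrtr_ge0.
by apply: ereal_sup_ubound; exists u => //; exists u.
Qed.

(** Monotonicity turns a bound on one [hdiam (S d)] into a bound near [0], and
    nonemptiness is what excludes the value [-oo] of the empty set. *)
Lemma hdiam_cvg0P (R : realType) (H1 H2 : hilbertType R)
    (S : R -> set (H1 * H2)) :
  (forall d e, d <= e -> S d `<=` S e) ->
  (forall e, 0 < e -> S e !=set0) ->
  (hdiam (S e) @[e --> 0^'+] --> 0%E) <->
  (forall r, 0 < r -> exists2 d, 0 < d &
     forall u v, S d u -> S d v -> hnorm (u - v) <= r).
Proof.
move=> S_mono S_neq0; split=> [S_cvg r r_gt0|S_small].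
  have /S_cvg small : nbhs 0%E [set x : \bar R | (x < r%:E)%E].
    apply: open_nbhs_nbhs; split; first exact: open_ereal_lt_ereal.
    by rewrite /= lte_fin.
  have [|d [d_gt0 Sd]] := @filter_ex _ (0^'+ : set_system R) _
      (fun d => 0 < d /\ (hdiam (S d) < r%:E)%E).
    by apply: filterI => //; exact: nbhs_right_gt.
  by exists d => //; apply/hdiam_le/ltW.
have S_fin : \forall e \near 0^'+, hdiam (S e) \is a fin_num.
  have [d d_gt0 Sd] := S_small 1 ltr01.
  near=> e; rewrite ge0_fin_numE.
    apply: (@le_lt_trans _ _ 1%:E); last exact: ltry.
    apply/hdiam_le => u v Su Sv.
    have ed : e <= d by near: e; exact: nbhs_right_le.
    by apply: Sd; apply: S_mono ed _ _.
  by apply/hdiam_ge0/S_neq0; near: e; exact: nbhs_right_gt.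
apply/fine_cvgP; split => //.
apply/cvgr0Pnorm_le => r /S_small[d d_gt0 Sd].
near=> e => /=.
have e_gt0 : 0 < e by near: e; exact: nbhs_right_gt.
have ed : e <= d by near: e; exact: nbhs_right_le.
rewrite ger0_norm ?fine_ge0 ?hdiam_ge0//; last exact: S_neq0.
rewrite -lee_fin fineK; last by near: e.
by apply/hdiam_le => u v Su Sv; apply: Sd; apply: S_mono ed _ _.
Unshelve. all: by end_near. Qed.

(** * Approximate solutions *)

Section Approximation.
Context {R : realType} {H1 H2 : hilbertType R}.
Variables (C : set H1) (Q : set H2) (A : {linear H1 -> H2}).
Variables (f : H1 -> H1 -> R) (g : H2 -> H2 -> R).

Local Notation sol := (sep_sol C Q A f g).
Local Notation approx := (sep_approx_sol C Q A f g).

Lemma sep_approx_sol_mono (d e : R) : d <= e -> approx d `<=` approx e.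
Proof.
move=> de z [CQz Az fz gz]; split => //.
- exact: le_trans de.
- by move=> p /fz; apply: le_trans; rewrite lerN2.
- by move=> q /gz; apply: le_trans; rewrite lerN2.
Qed.

Lemma sep_sol_sub_approx (e : R) : 0 <= e -> sol `<=` approx e.
Proof.
move=> e_ge0 z [CQz zA fz gz]; split => //.
- by rewrite zA subrr normr0.
- by move=> p /fz; apply: le_trans; rewrite oppr_le0.
- by move=> q /gz; apply: le_trans; rewrite oppr_le0.
Qed.

Lemma approximating_seq_harmonic (z : (H1 * H2)^nat) :
  (forall n, approx (harmonic n) (z n)) -> approximating_seq C Q A f g z.
Proof.
move=> Sz; exists harmonic; split => //; last exact: cvg_harmonic.
exact: harmonic_gt0.
Qed.

Hypotheses (C_closed : closed C) (Q_closed : closed Q).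
Hypothesis A_bounded : bounded_operator A.
Hypothesis f_usc : forall p, C p -> usc_on C (fun x => f x p).
Hypothesis g_usc : forall q, Q q -> usc_on Q (fun y => g y q).

(** Each defining condition of an approximate solution is closed: membership
    because [C] and [Q] are, the residual bound by continuity of [A], and the
    inequalities for [f] and [g] by upper semi-continuity. *)
Lemma approximating_seq_limit (z : (H1 * H2)^nat) (x : H1) (y : H2) :
  approximating_seq C Q A f g z ->
  (z n).1 @[n --> \oo] --> x -> (z n).2 @[n --> \oo] --> y -> sol (x, y).
Proof.
move=> [e [_ e0 Sz]] z_x z_y.
have Cz n : C (z n).1 by have [[]] := Sz n.
have Qz n : Q (z n).2 by have [[]] := Sz n.
have Cx : C x by exact: closed_cvg _ C_closed (nearW _ Cz) _ z_x.
have Qy : Q y by exact: closed_cvg _ Q_closed (nearW _ Qz) _ z_y.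
split => //=.
- have dist0 : (z n).2 - A (z n).1 @[n --> \oo] --> (0 : H2).
    apply/norm_cvg0P; apply: squeeze_cvgr (cvg_cst 0) e0.
    by apply: nearW => n; rewrite normr_ge0; have [] := Sz n.
  apply/subr0_eq/(cvg_unique _ _ dist0) => //.
  by apply: cvgB => //; exact: bounded_operator_cvg.
- move=> p Cp; apply: (usc_limit_ge0 (f_usc Cp) Cx Cz z_x e0) => n.
  by have [_ _ + _] := Sz n; exact.
- move=> q Qq; apply: (usc_limit_ge0 (g_usc Qq) Qy Qz z_y e0) => n.
  by have [_ _ _ +] := Sz n; exact.
Qed.

End Approximation.

Theorem theorem3p6 (R : realType) (H1 H2 : hilbertType R)
    (C : set H1) (Q : set H2) (A : {linear H1 -> H2})
    (f : H1 -> H1 -> R) (g : H2 -> H2 -> R)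
    (C_neq0 : C !=set0) (C_closed : closed C) (C_convex : convex_set C)
    (Q_neq0 : Q !=set0) (Q_closed : closed Q) (Q_convex : convex_set Q)
    (A_bounded : bounded_operator A)
    (f_usc : forall p, C p -> usc_on C (fun x => f x p))
    (g_usc : forall q, Q q -> usc_on Q (fun y => g y q)) :
  sep_well_posed C Q A f g <->
  (forall e : R, 0 < e -> sep_approx_sol C Q A f g e !=set0) /\
  hdiam (sep_approx_sol C Q A f g e) @[e --> (0 : R)^'+] --> (0 : \bar R)%E.
Proof.
pose S := sep_approx_sol C Q A f g.
have S_mono := @sep_approx_sol_mono _ _ _ C Q A f g.
split=> [[z0 sol_z0 z0_lim]|[S_neq0 /(hdiam_cvg0P S_mono S_neq0) S_small]].
  have solz0 : sep_sol C Q A f g z0 by rewrite sol_z0.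
  have S_neq0 e : 0 < e -> S e !=set0.
    by move=> /ltW e_ge0; exists z0; exact: sep_sol_sub_approx solz0.
  split=> //; apply/(hdiam_cvg0P S_mono S_neq0) => r r_gt0.
  have r4_gt0 : 0 < r / 4 by rewrite divr_gt0.
  suff [n Sn] : exists n, forall z, S (harmonic n) z -> hnorm (z - z0) <= r / 4.
    exists (harmonic n) => [|u v /Sn u_z0 /Sn v_z0]; first exact: harmonic_gt0.
    by rewrite -[r](@divfK _ 4)// mulr_natr; exact: hnorm_dist_le u_z0 v_z0.
  (* A counterexample in every [S (1 / n.+1)] yields an approximating sequence
     that stays away from [z0]. *)
  apply: contrapT => /forallNP far.
  have /choice[z z_far] n : exists z, S (harmonic n) z /\ r / 4 < hnorm (z - z0).
    have /existsNP[z /not_implyP[Sz /negP]] := far n.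
    by rewrite -ltNge; exists z.
  have /z0_lim z_z0 : approximating_seq C Q A f g z.
    by apply: approximating_seq_harmonic => n; have [] := z_far n.
  have [N _ /(_ N (leqnn N))] := cvgr0_norm_lt _ z_z0 _ r4_gt0.
  rewrite ger0_norm ?sqrtr_ge0//; apply/negP.
  by rewrite -leNgt ltW//; have [] := z_far N.
have /choice[z Sz] n : exists z, S (harmonic n) z.
  by apply: S_neq0; exact: harmonic_gt0.
have z_cauchy r : 0 < r ->
    exists N, forall n, (N <= n)%N -> hnorm (z N - z n) <= r.
  move=> /S_small[d d_gt0 Sd].
  have [N _ SN] := cvgr0_norm_le _ (@cvg_harmonic R) _ d_gt0.
  have SdN n : (N <= n)%N -> S d (z n).
    move=> /SN /=; rewrite ger0_norm ?harmonic_ge0// => nd.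
    exact: S_mono nd _ (Sz n).
  by exists N => n Nn; apply: Sd; exact: SdN.
have /cvg_ex[x z_x] : cvgn (fun n => (z n).1).
  apply: dist_small_cvgn => r /z_cauchy[N zN]; exists N => n /zN.
  exact: le_trans (ler_hnorm1 _).
have /cvg_ex[y z_y] : cvgn (fun n => (z n).2).
  apply: dist_small_cvgn => r /z_cauchy[N zN]; exists N => n /zN.
  exact: le_trans (ler_hnorm2 _).
have solxy : sep_sol C Q A f g (x, y).
  apply: approximating_seq_limit z_x z_y => //.
  exact: approximating_seq_harmonic.
exists (x, y).
  (* Two solutions lie in every [S d], hence at distance at most every
     [r > 0]. *)
  apply/seteqP; split => [w solw|_ ->//] /=; apply/subr0_eq/hnorm_le0_eq0.
  apply/ler_addgt0Pr => r /S_small[d /ltW d_ge0 Sd]; rewrite add0r.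
  by apply: Sd; exact: sep_sol_sub_approx.
move=> w [e [e_gt0 e0 Sw]]; apply/cvgr0Pnorm_le => r /S_small[d d_gt0 Sd].
have [N _ eN] := cvgr0_norm_le _ e0 _ d_gt0; exists N => // n /eN /=.
rewrite (ger0_norm (ltW (e_gt0 n))) ger0_norm ?sqrtr_ge0// => en_d.
by apply: Sd; [exact: S_mono en_d _ (Sw n)|exact: sep_sol_sub_approx (ltW _) _ _].
Qed.
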